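(* For every $n\in\mathbb{N}$, $\mathcal{IOP}_n$ is an inverse subsemigroup of $\mathcal{IP}_n$.
   Context: Let $X$ be an arbitrary set and let $X'=\{x':x\in X\}$ be a disjoint copy of $X$, with $x\mapsto x'$ a fixed bijection $X\to X'$; the inverse bijection is also denoted by $'$, and $B'=\{x':x\in B\}$ for $B\subseteq X$. Let $\mathcal{CS}_X$ be the set of all partitions of $X\cup X'$ into nonempty blocks. For $a\in\mathcal{CS}_X$ write $x\equiv_a y$ if $x,y\in X\cup X'$ lie in the same block of $a$. The product $ab$ of $a,b\in\mathcal{CS}_X$ is the partition corresponding to the equivalence relation $\equiv$ on $X\cup X'$ defined, for $x,y\in X$, by: (i) $x\equiv y$ iff $x\equiv_a y$ or there are $s\ge 1$ and $c_1,\dots,c_{2s}\in X$ with $x\equiv_a c_1'$, $c_1\equiv_b c_2$, $c_2'\equiv_a c_3'$, $\dots$, $c_{2s-1}\equiv_b c_{2s}$, $c_{2s}'\equiv_a y$; (ii) $x'\equiv y'$ iff $x'\equiv_b y'$ or there are $s\ge 1$ and $c_1,\dots,c_{2s}\in X$ with $x'\equiv_b c_1$, $c_1'\equiv_a c_2'$, $c_2\equiv_b c_3$, $\dots$, $c_{2s-1}'\equiv_a c_{2s}'$, $c_{2s}\equiv_b y'$; (iii) $x\equiv y'$ iff $y'\equiv x$ iff there are $s\ge 1$ and $c_1,\dots,c_{2s-1}\in X$ with $x\equiv_a c_1'$, $c_1\equiv_b c_2$, $c_2'\equiv_a c_3'$, $\dots$, $c_{2s-2}'\equiv_a c_{2s-1}'$,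 $c_{2s-1}\equiv_b y'$. With this product $\mathcal{CS}_X$ is a semigroup, and $\mathcal{IP}_X$ is the subsemigroup (an inverse semigroup) of all $a\in\mathcal{CS}_X$ each of whose blocks meets both $X$ and $X'$. For $X=\{1,\dots,n\}$ write $\mathcal{IP}_n$. An element of $\mathcal{IP}_n$ is written $a=(A_i\cup B_i')_{i\in I}$, where the $A_i\cup B_i'$ are its blocks and $A_i,B_i\subseteq\{1,\dots,n\}$ are nonempty. For nonempty $A\subseteq\{1,\dots,n\}$ let $\min_A$ be the least element of $A$ in the natural order. $\mathcal{IOP}_n$ is the set of all $a=(A_i\cup B_i')_{i\in I}\in\mathcal{IP}_n$ such that for all $i,j\in I$: $\min_{A_i}\le\min_{A_j}$ implies $\min_{B_i}\le\min_{B_j}$. An inverse subsemigroup is a subsemigroup closed under taking inverses. *)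

(* Defs.v *)
From mathcomp Require Import all_boot.
From mathcomp Require Import boolp.

Set Implicit Arguments.
Unset Strict Implicit.
Unset Printing Implicit Defensive.

Section Partitions.
Variable X : finType.

(* The disjoint union of X and X' is the sum type X + X: [inl x] stands for x  *)
(* and [inr x] for x'.                                                         *)
Definition CS : {set {set {set X + X}}} := [set a | partition a [set: X + X]].

Definition same_block (a : {set {set X + X}}) (u v : X + X) : bool :=
  [exists B in a, (u \in B) && (v \in B)].

(* In the three definitions below the sequence c_1, c_2, ... is a function     *)
(* c : nat -> X of which only the values at the indices 1, ..., 2s             *)
(* (resp. 1, ..., 2s - 1) are constrained.                                     *)
Definition link_upper (a b : {set {set X + X}}) (x y : X) : Prop :=
  same_block a (inl x) (inl y) \/
  exists (s : nat) (c : nat -> X),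
    [/\ 1 <= s,
        same_block a (inl x) (inr (c 1)),
        forall i, 1 <= i <= s -> same_block b (inl (c (2 * i - 1))) (inl (c (2 * i))),
        forall i, 1 <= i < s -> same_block a (inr (c (2 * i))) (inr (c (2 * i + 1)))
      & same_block a (inr (c (2 * s))) (inl y)].

Definition link_lower (a b : {set {set X + X}}) (x y : X) : Prop :=
  same_block b (inr x) (inr y) \/
  exists (s : nat) (c : nat -> X),
    [/\ 1 <= s,
        same_block b (inr x) (inl (c 1)),
        forall i, 1 <= i <= s -> same_block a (inr (c (2 * i - 1))) (inr (c (2 * i))),
        forall i, 1 <= i < s -> same_block b (inl (c (2 * i))) (inl (c (2 * i + 1)))
      & same_block b (inl (c (2 * s))) (inr y)].

Definition link_through (a b : {set {set X + X}}) (x y : X) : Prop :=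
  exists (s : nat) (c : nat -> X),
    [/\ 1 <= s,
        same_block a (inl x) (inr (c 1)),
        forall i, 1 <= i < s -> same_block b (inl (c (2 * i - 1))) (inl (c (2 * i))),
        forall i, 1 <= i < s -> same_block a (inr (c (2 * i))) (inr (c (2 * i + 1)))
      & same_block b (inl (c (2 * s - 1))) (inr y)].

Definition cs_link (a b : {set {set X + X}}) (u v : X + X) : Prop :=
  match u, v with
  | inl x, inl y => link_upper a b x y
  | inr x, inr y => link_lower a b x y
  | inl x, inr y => link_through a b x y
  | inr y, inl x => link_through a b x y
  end.

(* The product is defined on arbitrary sets of subsets of X + X; it is         *)
(* meaningful when [a] and [b] belong to [CS].                                 *)
Definition cs_mul (a b : {set {set X + X}}) : {set {set X + X}} :=
  equivalence_partition (fun u v => `[< cs_link a b u v >]) [set: X + X].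

(* A block is A :|: B' with A = upper_part and B = lower_part. *)
Definition upper_part (P : {set X + X}) : {set X} := [set x | inl x \in P].
Definition lower_part (P : {set X + X}) : {set X} := [set x | inr x \in P].

Definition IP : {set {set {set X + X}}} :=
  [set a in CS | [forall P in a, (upper_part P != set0) && (lower_part P != set0)]].

End Partitions.

(* The least element of A, as a natural number; the value n for A = set0 is    *)
(* junk and never occurs for the parts of a block of an element of [IP].       *)
Definition min_set (n : nat) (A : {set 'I_n}) : nat := \big[minn/n]_(i in A) i.

Definition IOP (n : nat) : {set {set {set 'I_n + 'I_n}}} :=
  [set a in IP 'I_n |
    [forall P in a, forall Q in a,
      (min_set (upper_part P) <= min_set (upper_part Q)) ==>
      (min_set (lower_part P) <= min_set (lower_part Q))]].

Definition semigroup_inverse (T : finType) (mul : T -> T -> T) (S : {set T})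
    (a b : T) : Prop :=
  [/\ b \in S, mul (mul a b) a = a & mul (mul b a) b = b].

Definition subsemigroup (T : finType) (mul : T -> T -> T) (S U : {set T}) : Prop :=
  [/\ U != set0, U \subset S & {in U &, forall a b, mul a b \in U}].

(* Closure under inverses: every a in U has exactly one inverse in the ambient *)
(* semigroup S, and this inverse lies in U.                                    *)
Definition inverse_subsemigroup (T : finType) (mul : T -> T -> T)
    (S U : {set T}) : Prop :=
  subsemigroup mul S U /\
  {in U, forall a, exists b, unique (semigroup_inverse mul S a) b /\ b \in U}.

(* Main.v *)
(* An element a of IP_n is determined by the pairs (x, y') lying in a common   *)
(* block; let K_a and L_a be the equivalences it induces on X and on X'.  Two  *)
(* vertices are linked in ab exactly when they reach the same class of the     *)
(* join of L_a and K_b on the middle row, which makes ab a partition in IP_n.  *)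
(* Turning a upside down gives an inverse; it is the only one, since aba = a   *)
(* forces K_b to lie in L_a, and likewise with a and b exchanged.              *)
(* For the order, both sides of a block of ab are unions of sides of blocks of *)
(* a or b, and a preserves the comparison of minima not only between blocks    *)
(* but also between unions of blocks, so the comparison passes from the top    *)
(* row to the middle row, and from there to the bottom row.                    *)
Require Import Defs.
From mathcomp Require Import all_boot.
From mathcomp Require Import boolp.

Set Implicit Arguments.
Unset Strict Implicit.
Unset Printing Implicit Defensive.

(** [cs_linkP] merges the three linking rules into one: outer vertices are linked iff they attach to
    middle vertices connected by [middle_step]. This gives [cs_mul_IP] and, through two uses of
    [IOP_saturated], closure under products in [cs_mul_IOP]. The inverse of [a] is [flip a]:
    [mul_flip_mul] shows that it is one, [inverse_through_sub] that there is no other. It stays in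
    [IOP n] because distinct blocks have disjoint lower parts, hence distinct lower minima, so order
    preservation can also be read from bottom to top ([flip_IOP]). *)

(** * Alternating walks and connectivity *)

(* As both relations are reflexive, a walk mixing their steps becomes strictly *)
(* alternating by inserting trivial steps.                                     *)
Lemma connect_alternating (T : finType) (e f : rel T) (y z : T) :
    reflexive e -> reflexive f -> connect [rel u v | e u v || f u v] y z ->
  exists (s : nat) (c : nat -> T),
    [/\ 1 <= s, c 1 = y /\ c (2 * s - 1) = z, c (2 * s) = z,
        forall i, 1 <= i <= s -> e (c (2 * i - 1)) (c (2 * i))
      & forall i, 1 <= i < s -> f (c (2 * i)) (c (2 * i + 1))].
Proof.
move=> erefl frefl /connectP[p path_p ->]; set w := last y p.
(* The default [w] prolongs the walk by its endpoint. Odd indices of [c] carry the vertices of the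
   walk; between two of them, [c] moves at once if the step is in [e], and otherwise waits and moves
   by [f]. *)
pose d i := nth w (y :: p) i.
pose c i := if odd i then d i./2
            else if e (d i./2.-1) (d i./2) then d i./2 else d i./2.-1.
have codd i : c (2 * i + 1) = d i.
  by rewrite /c mul2n addn1 oddS odd_double /= uphalf_double.
have codd' i : 1 <= i -> c (2 * i - 1) = d i.-1.
  by case: i => // i _; rewrite mulnS add2n subn1 /= -codd addn1.
have ceven i : c (2 * i) = if e (d i.-1) (d i) then d i else d i.-1.
  by rewrite /c mul2n odd_double /= doubleK.
have dlast : d (size p) = w by rewrite /d /w; case: (p) => //= x q; rewrite -last_nth.
have dend : d (size p).+1 = w by rewrite /d nth_default.
exists (size p).+1, c; split=> //.
- by split; [rewrite -[1]/(2 * 0 + 1) codd | rewrite codd'].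
- by rewrite ceven /= dlast dend if_same.
- by move=> i /andP[i_gt0 _]; rewrite codd' // ceven; case: ifP.
- case=> // i /andP[_ lt_i]; rewrite codd ceven /=; case: ifP => [_|ne].
    exact: frefl.
  have /= := pathP w path_p i lt_i.
  by rewrite -/(d i) -[nth w p i]/(d i.+1) ne.
Qed.

(** The walk stops at index [2 * s - 1], as in [link_through]; the other two kinds of link append
    one more step. *)
Lemma alternating_connect (T : finType) (e f : rel T) (s : nat) (c : nat -> T) :
    1 <= s ->
    (forall i, 1 <= i < s -> e (c (2 * i - 1)) (c (2 * i))) ->
    (forall i, 1 <= i < s -> f (c (2 * i)) (c (2 * i + 1))) ->
  connect [rel u v | e u v || f u v] (c 1) (c (2 * s - 1)).
Proof.
elim: s => // -[|s] IHs _ e_c f_c //.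
have{IHs} IHs : connect [rel u v | e u v || f u v] (c 1) (c (2 * s.+1 - 1)).
  by apply: IHs => // i /andP[i_gt0 lt_i]; [apply: e_c | apply: f_c];
     rewrite i_gt0 (ltn_trans lt_i).
have lt_s : 1 <= s.+1 < s.+2 by rewrite /=.
apply: connect_trans IHs _.
apply: (@connect_trans _ _ (c (2 * s.+1))); apply: connect1 => /=.
  by rewrite e_c.
by have := f_c _ lt_s; rewrite addn1 [2 * s.+2]mulnS add2n subn1 /= => ->; rewrite orbT.
Qed.

(** * Partitions through their same-block relation *)

Section Blocks.
Variable X : finType.
Implicit Types (a b : {set {set X + X}}) (u v w : X + X) (x y z : X).

Lemma mem_pblock_CS a u v : a \in CS X -> (v \in pblock a u) = same_block a u v.
Proof.
rewrite inE => part_a; have tiP := partition_trivIset part_a.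
have in_cover w : w \in cover a by rewrite (cover_partition part_a) inE.
apply/idP/existsP => [v_in|[B /and3P[aB Bu Bv]]].
  by exists (pblock a u); rewrite pblock_mem // mem_pblock in_cover.
by rewrite (def_pblock tiP aB Bu).
Qed.

Lemma same_blockE a u v : a \in CS X -> same_block a u v = (pblock a u == pblock a v).
Proof.
move=> aCS; rewrite -mem_pblock_CS //; move: aCS; rewrite inE => part_a.
by rewrite eq_pblock ?(partition_trivIset part_a) // (cover_partition part_a) inE.
Qed.

Lemma same_block_refl a u : a \in CS X -> same_block a u u.
Proof. by move=> aCS; rewrite same_blockE. Qed.

Lemma same_block_sym a u v : same_block a u v = same_block a v u.
Proof. by apply: eq_existsb => B; rewrite [(u \in B) && _]andbC. Qed.

Lemma same_block_trans a u v w :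
  a \in CS X -> same_block a u v -> same_block a v w -> same_block a u w.
Proof. by move=> aCS; rewrite !same_blockE // => /eqP->. Qed.

Lemma CS_ext a b : a \in CS X -> b \in CS X ->
  (forall u v, same_block a u v = same_block b u v) -> a = b.
Proof.
have CS_def c : c \in CS X ->
    c = equivalence_partition (fun u v => same_block c u v) [set: X + X].
  move=> cCS; have := cCS; rewrite inE => part_c.
  rewrite -{1}(equivalence_partition_pblock part_c).
  by apply: eq_imset => u; apply/setP=> v; rewrite !inE /= mem_pblock_CS.
move=> aCS bCS eq_ab; rewrite (CS_def a) // (CS_def b) //.
by apply: eq_imset => u; apply/setP=> v; rewrite !inE eq_ab.
Qed.

Lemma equivalence_partition_CS (r : rel (X + X)) :
    reflexive r -> symmetric r -> transitive r ->
  equivalence_partition r [set: X + X] \in CS X /\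
  same_block (equivalence_partition r [set: X + X]) =2 r.
Proof.
move=> rr rs rt.
have eqR : {in [set: X + X] & &, equivalence_rel r}.
  move=> u v w _ _ _; split=> // ruv.
  by apply/idP/idP; apply: rt; rewrite // rs.
have part_r := equivalence_partitionP eqR.
split=> [|u v]; first by rewrite inE.
by rewrite -mem_pblock_CS ?inE // (pblock_equivalence_partition eqR) ?inE.
Qed.

Lemma block_pblock a (P : {set X + X}) : a \in CS X -> P \in a -> exists u, P = pblock a u.
Proof.
rewrite inE => part_a aP.
have /set0Pn[u Pu] : P != set0.
  by case/and3P: part_a => _ _; apply: contraNneq => <-.
by exists u; rewrite (def_pblock (partition_trivIset part_a) aP Pu).
Qed.

Lemma pblock_CS a u : a \in CS X -> pblock a u \in a.
Proof. by rewrite inE => part_a; rewrite pblock_mem // (cover_partition part_a) inE. Qed.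

Definition uppers a u : {set X} := [set x | same_block a u (inl x)].
Definition lowers a u : {set X} := [set x | same_block a u (inr x)].

Lemma upper_pblock a u : a \in CS X -> upper_part (pblock a u) = uppers a u.
Proof. by move=> aCS; apply/setP=> x; rewrite !inE mem_pblock_CS. Qed.

Lemma lower_pblock a u : a \in CS X -> lower_part (pblock a u) = lowers a u.
Proof. by move=> aCS; apply/setP=> x; rewrite !inE mem_pblock_CS. Qed.

Lemma IP_CS a : a \in IP X -> a \in CS X.
Proof. by rewrite inE => /andP[]. Qed.

Lemma IP_intro a : a \in CS X ->
  (forall u, exists x, same_block a u (inl x)) ->
  (forall u, exists x, same_block a u (inr x)) -> a \in IP X.
Proof.
move=> aCS up lo; rewrite inE aCS /=.
apply/forall_inP => P /(block_pblock aCS)[u ->].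
rewrite upper_pblock // lower_pblock //; apply/andP; split; apply/set0Pn.
  by have [x ux] := up u; exists x; rewrite inE.
by have [x ux] := lo u; exists x; rewrite inE.
Qed.

Lemma IP_upper a u : a \in IP X -> exists x, same_block a u (inl x).
Proof.
move=> aIP; have aCS := IP_CS aIP; move: aIP; rewrite inE => /andP[_ /forall_inP].
move=> /(_ _ (pblock_CS u aCS)); rewrite upper_pblock // => /andP[/set0Pn[x]].
by rewrite inE; exists x.
Qed.

Lemma IP_lower a u : a \in IP X -> exists x, same_block a u (inr x).
Proof.
move=> aIP; have aCS := IP_CS aIP; move: aIP; rewrite inE => /andP[_ /forall_inP].
move=> /(_ _ (pblock_CS u aCS)); rewrite lower_pblock // => /andP[_ /set0Pn[x]].
by rewrite inE; exists x.
Qed.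

(** Every block has an upper and a lower vertex, so links within one row factor through a vertex of
    the other row. *)
Lemma IP_ext a b : a \in IP X -> b \in IP X ->
  (forall x y, same_block a (inl x) (inr y) = same_block b (inl x) (inr y)) -> a = b.
Proof.
move=> aIP bIP eq_ab; apply: CS_ext (IP_CS aIP) (IP_CS bIP) _ => u v.
wlog suff: a b aIP bIP eq_ab / same_block a u v -> same_block b u v.
  by move=> H; apply/idP/idP; apply: H.
have [aCS bCS] := (IP_CS aIP, IP_CS bIP) => uv.
have [x ux] := IP_upper u aIP; have [y uy] := IP_lower u aIP.
have sb w : same_block a u w -> same_block b (inl x) w.
  move=> uw; have xw : same_block a (inl x) w.
    by apply: same_block_trans uw; rewrite // same_block_sym.
  case: w uw xw => z uz; last by rewrite eq_ab.
  move=> _; have xy : same_block a (inl x) (inr y).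
    by apply: same_block_trans uy; rewrite // same_block_sym.
  have zy : same_block a (inl z) (inr y).
    by apply: same_block_trans uy; rewrite // same_block_sym.
  rewrite eq_ab in xy; rewrite eq_ab same_block_sym in zy.
  exact: same_block_trans xy zy.
apply: same_block_trans (sb v uv); first by [].
by rewrite same_block_sym sb // same_block_refl.
Qed.

(** * The product as connectivity in the middle row *)

(* In the diagram of [a] stacked on [b], the bottom row of [a] is glued to the *)
(* top row of [b]: [middle a b u y] says that the outer vertex [u] is joined   *)
(* to the vertex [y] of this glued row by a single block.                      *)
Definition middle a b u y : bool :=
  match u with
  | inl x => same_block a (inl x) (inr y)
  | inr x => same_block b (inr x) (inl y)
  end.

Definition middle_step a b : rel X :=
  [rel y z | same_block b (inl y) (inl z) || same_block a (inr y) (inr z)].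

Section Product.
Variables a b : {set {set X + X}}.
Hypotheses (aIP : a \in IP X) (bIP : b \in IP X).
Let aCS := IP_CS aIP.
Let bCS := IP_CS bIP.

Lemma connect_middle_sym : connect_sym (middle_step a b).
Proof.
apply: sym_connect_sym => y z; rewrite /middle_step /=.
by rewrite same_block_sym [same_block a _ _]same_block_sym.
Qed.

Lemma middle_ex u : exists y, middle a b u y.
Proof. by case: u => x; [apply: IP_lower | apply: IP_upper]. Qed.

Lemma middle_connect u y z :
  middle a b u y -> middle a b u z -> connect (middle_step a b) y z.
Proof.
case: u => x /=; rewrite same_block_sym => yx xz; apply: connect1; rewrite /middle_step /=.
  by rewrite (same_block_trans aCS yx xz) orbT.
by rewrite (same_block_trans bCS yx xz).
Qed.

Lemma cs_linkP u v : cs_link a b u v <->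
  exists y z, [/\ middle a b u y, middle a b v z & connect (middle_step a b) y z].
Proof.
have bl : reflexive [rel y z | same_block b (inl y) (inl z)].
  by move=> y; apply: same_block_refl.
have ar : reflexive [rel y z | same_block a (inr y) (inr z)].
  by move=> y; apply: same_block_refl.
have comm y z : connect (middle_step a b) y z =
    connect [rel y z | same_block a (inr y) (inr z) || same_block b (inl y) (inl z)] y z.
  by apply: eq_connect => ? ?; rewrite /middle_step /= orbC.
have through x x' : link_through a b x x' <-> exists y z,
    [/\ middle a b (inl x) y, middle a b (inr x') z & connect (middle_step a b) y z].
  split=> [[s [c [s_gt0 xc bc ac cx']]]|[y [z [xy x'z con]]]].
    exists (c 1), (c (2 * s - 1)); split=> //=; first by rewrite same_block_sym.
    exact: (@alternating_connect _ [rel y z | same_block b (inl y) (inl z)]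
              [rel y z | same_block a (inr y) (inr z)]).
  have [s [c [s_gt0 [c1 c2s] _ bc ac]]] := connect_alternating bl ar con.
  exists s, c; split=> //; first by rewrite c1.
    by move=> i /andP[i_gt0 /ltnW le_is]; apply: bc; rewrite i_gt0.
  by rewrite c2s same_block_sym.
case: u v => [x|x] [x'|x'] //=.
- split=> [[xx'|[s [c [s_gt0 xc bc ac cx']]]]|[y [z [xy x'z con]]]].
  + have [y xy] := IP_lower (inl x) aIP; exists y, y; split=> //.
    by apply: same_block_trans xy; rewrite // same_block_sym.
  + exists (c 1), (c (2 * s)); split=> //=; first by rewrite same_block_sym.
    (* The last step, from index [2 * s - 1] to [2 * s], is added by hand. *)
    apply: connect_trans (connect1 _).
      apply: (@alternating_connect _ [rel y z | same_block b (inl y) (inl z)]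
              [rel y z | same_block a (inr y) (inr z)] s) => // i /andP[i_gt0 /ltnW le_is].
      by apply: bc; rewrite i_gt0.
    by rewrite /middle_step /= bc // s_gt0 leqnn.
  + have [s [c [s_gt0 [c1 _] c2s bc ac]]] := connect_alternating bl ar con.
    by right; exists s, c; split; rewrite ?c1 ?c2s // same_block_sym.
- rewrite through; split=> -[y [z [? ? ?]]]; exists z, y; split=> //;
  by rewrite connect_middle_sym.
- split=> [[xx'|[s [c [s_gt0 xc bc ac cx']]]]|[y [z [xy x'z con]]]].
  + have [y xy] := IP_upper (inr x) bIP; exists y, y; split=> //.
    by apply: same_block_trans xy; rewrite // same_block_sym.
  + exists (c 1), (c (2 * s)); split=> //=; first by rewrite same_block_sym.
    rewrite comm; apply: connect_trans (connect1 _).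
      apply: (@alternating_connect _ [rel y z | same_block a (inr y) (inr z)]
              [rel y z | same_block b (inl y) (inl z)] s) => // i /andP[i_gt0 /ltnW le_is].
      by apply: bc; rewrite i_gt0.
    by rewrite /middle_step /= bc // s_gt0 leqnn.
  + rewrite comm in con.
    have [s [c [s_gt0 [c1 _] c2s bc ac]]] := connect_alternating ar bl con.
    by right; exists s, c; split; rewrite ?c1 ?c2s // same_block_sym.
Qed.

(** Transitivity holds because any two middle vertices attached to the same outer vertex are
    connected ([middle_connect]). *)
Lemma cs_mul_CS :
  cs_mul a b \in CS X /\ forall u v, same_block (cs_mul a b) u v = `[< cs_link a b u v >].
Proof.
apply: equivalence_partition_CS.
- move=> u; apply/asboolP/cs_linkP; have [y uy] := middle_ex u.
  by exists y, y; split.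
- move=> u v; apply/asboolP/asboolP => /cs_linkP[y [z [? ? ?]]]; apply/cs_linkP;
  by exists z, y; split=> //; rewrite connect_middle_sym.
- move=> v u w /asboolP/cs_linkP[y [z [uy vz yz]]] /asboolP/cs_linkP[y' [z' [vy' wz' yz']]].
  apply/asboolP/cs_linkP; exists y, z'; split=> //.
  exact: connect_trans yz (connect_trans (middle_connect vz vy') yz').
Qed.

Lemma same_block_mulP u v : reflect
  (exists y z, [/\ middle a b u y, middle a b v z & connect (middle_step a b) y z])
  (same_block (cs_mul a b) u v).
Proof.
rewrite cs_mul_CS.2; apply: (iffP idP) => [/asboolP/cs_linkP //|H].
exact/asboolP/cs_linkP.
Qed.

Lemma cs_mul_IP : cs_mul a b \in IP X.
Proof.
apply: IP_intro => [|u|u]; first exact: cs_mul_CS.1.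
  have [y uy] := middle_ex u; have [x yx] := IP_upper (inr y) aIP.
  by exists x; apply/same_block_mulP; exists y, y; split; rewrite //= same_block_sym.
have [y uy] := middle_ex u; have [x yx] := IP_lower (inl y) bIP.
by exists x; apply/same_block_mulP; exists y, y; split; rewrite //= same_block_sym.
Qed.

Lemma mul_upper x x' : same_block a (inl x) (inl x') ->
  same_block (cs_mul a b) (inl x) (inl x').
Proof. by move=> xx'; rewrite cs_mul_CS.2; apply/asboolP; left. Qed.

Lemma mul_lower x x' : same_block b (inr x) (inr x') ->
  same_block (cs_mul a b) (inr x) (inr x').
Proof. by move=> xx'; rewrite cs_mul_CS.2; apply/asboolP; left. Qed.

Lemma mul_through x y z : same_block a (inl x) (inr y) -> same_block b (inl y) (inr z) ->
  same_block (cs_mul a b) (inl x) (inr z).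
Proof.
by move=> xy yz; apply/same_block_mulP; exists y, y; split; rewrite //= same_block_sym.
Qed.

(** Under this hypothesis every middle step stays within one block of [a], so a whole walk collapses
    to a single middle vertex. *)
Lemma mul_throughP x z :
    (forall y y', same_block b (inl y) (inl y') -> same_block a (inr y) (inr y')) ->
  same_block (cs_mul a b) (inl x) (inr z) =
  [exists y, same_block a (inl x) (inr y) && same_block b (inl y) (inr z)].
Proof.
move=> sub_ba; apply/same_block_mulP/existsP => [[y [y' [/= xy zy' con]]]|[y /andP[xy yz]]].
  exists y'; rewrite [same_block b _ _]same_block_sym zy' andbT.
  apply: same_block_trans xy _ => //.
  case/connectP: con => p path_p ->.
  elim: p y path_p => [|t p IHp] y /=; first by rewrite same_block_refl.
  case/andP=> yt path_p; apply: same_block_trans (IHp _ path_p) => //.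
  by case/orP: yt => // /sub_ba.
by exists y, y; split; rewrite //= same_block_sym.
Qed.

End Product.

(** * Existence and uniqueness of inverses *)

Definition swap u : X + X := match u with inl x => inr x | inr x => inl x end.

Definition flip a : {set {set X + X}} :=
  equivalence_partition (fun u v => same_block a (swap u) (swap v)) [set: X + X].

Lemma flip_CS a : a \in CS X ->
  flip a \in CS X /\ forall u v, same_block (flip a) u v = same_block a (swap u) (swap v).
Proof.
move=> aCS; apply: (@equivalence_partition_CS
    (fun u v => same_block a (swap u) (swap v))) => [u|u v|v u w].
- exact: same_block_refl.
- exact: same_block_sym.
- exact: same_block_trans.
Qed.

Lemma flip_IP a : a \in IP X -> flip a \in IP X.
Proof.
move=> aIP; have [fCS fE] := flip_CS (IP_CS aIP); apply: IP_intro => // u.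
  by have [x ux] := IP_lower (swap u) aIP; exists x; rewrite fE.
by have [x ux] := IP_upper (swap u) aIP; exists x; rewrite fE.
Qed.

Lemma flipK a : a \in CS X -> flip (flip a) = a.
Proof.
move=> aCS; have [fCS fE] := flip_CS aCS; have [ffCS ffE] := flip_CS fCS.
by apply: CS_ext => // -[u|u] [v|v]; rewrite ffE fE.
Qed.

Lemma mul_flip_mul a : a \in IP X -> cs_mul (cs_mul a (flip a)) a = a.
Proof.
move=> aIP; have aCS := IP_CS aIP; have fIP := flip_IP aIP.
have fE := (flip_CS aCS).2; have mIP := cs_mul_IP aIP fIP.
apply: IP_ext => [||x z] //; first exact: cs_mul_IP.
rewrite mul_throughP // => [|y y' yy']; last by apply: mul_lower; rewrite ?fE.
apply/existsP/idP => [[y /andP[]]|xz]; last first.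
  exists x; rewrite xz andbT.
  by apply: (mul_through aIP fIP xz); rewrite fE /= same_block_sym.
rewrite mul_throughP // => [/existsP[t /andP[xt]]|t t']; rewrite fE //= => ty yz.
by apply: same_block_trans (yz) => //; apply: same_block_trans xt ty.
Qed.

(** Choose [x], [x'] above [y], [y'] in [a]. The link in [b] joins them in [ab], hence in [aba = a],
    which brings [y] and [y'] into one block of [a]. *)
Lemma inverse_kernel_sub a b y y' : a \in IP X -> b \in IP X ->
    cs_mul (cs_mul a b) a = a ->
  same_block b (inl y) (inl y') -> same_block a (inr y) (inr y').
Proof.
move=> aIP bIP aba yy'; have aCS := IP_CS aIP; have mIP := cs_mul_IP aIP bIP.
have [x yx] := IP_upper (inr y) aIP; have [x' y'x'] := IP_upper (inr y') aIP.
have xx' : same_block a (inl x) (inl x').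
  rewrite -aba; apply: mul_upper => //; apply/same_block_mulP => //.
  exists y, y'; rewrite /middle ![same_block a (inl _) _]same_block_sym.
  by split=> //; apply: connect1; rewrite /middle_step /= yy'.
apply: same_block_trans yx _ => //; apply: same_block_trans xx' _ => //.
by rewrite same_block_sym.
Qed.

(** Go from [x] down through [a], [b], [a] to [z], [w], [v]. As [aba = a], [w] and [x] are in one
    block of [a]; [inverse_kernel_sub] carries this to the bottom row of [b], so [z] and [y] share a
    block of [b], and then, by the same lemma, one of [a]. *)
Lemma inverse_through_sub a b x y : a \in IP X -> b \in IP X ->
    cs_mul (cs_mul a b) a = a -> cs_mul (cs_mul b a) b = b ->
  same_block b (inl y) (inr x) -> same_block a (inl x) (inr y).
Proof.
move=> aIP bIP aba bab yx; have [aCS bCS] := (IP_CS aIP, IP_CS bIP).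
have [z xz] := IP_lower (inl x) aIP.
have [w zw] := IP_lower (inl z) bIP.
have [v wv] := IP_lower (inl w) aIP.
have xv : same_block a (inl x) (inr v).
  by rewrite -aba; apply: mul_through (mul_through _ _ xz zw) wv => //; exact: cs_mul_IP.
have wx : same_block a (inl w) (inl x).
  by apply: same_block_trans wv _; rewrite // same_block_sym.
have zy : same_block b (inl z) (inl y).
  apply: same_block_trans zw _ => //.
  apply: same_block_trans (inverse_kernel_sub bIP aIP bab wx) _ => //.
  by rewrite same_block_sym.
exact: same_block_trans xz (inverse_kernel_sub aIP bIP aba zy).
Qed.

Lemma flip_unique_inverse a : a \in IP X ->
  unique (semigroup_inverse (@cs_mul X) (IP X) a) (flip a).
Proof.
move=> aIP; have aCS := IP_CS aIP; have fIP := flip_IP aIP; split.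
  split=> //; first exact: mul_flip_mul.
  by rewrite -{2}(flipK aCS) mul_flip_mul.
move=> b [bIP aba bab]; apply: IP_ext => // x y.
rewrite (flip_CS aCS).2 /= same_block_sym.
by apply/idP/idP; apply: inverse_through_sub.
Qed.

End Blocks.

(** * Minima and order preservation *)

Section Order.
Variable n : nat.
Implicit Types (A B : {set 'I_n}) (a b : {set {set 'I_n + 'I_n}}).

(** The conjunct [m <= n] accounts for the default value [n] at the empty set. *)
Lemma leq_min_setP A m : reflect (m <= n /\ forall x, x \in A -> m <= x) (m <= min_set A).
Proof.
apply: (iffP idP) => [le_mA|[le_mn le_mA]]; last first.
  by rewrite /min_set; elim/big_ind: _ => // p q mp mq; rewrite leq_min mp.
suff le_min k : k <= min_set A -> k <= n /\ forall x, x \in A -> k <= x by apply: le_min.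
move=> le_k; split=> [|x Ax].
  apply: leq_trans le_k _; rewrite /min_set.
  by elim/big_rec: _ => // i p _; rewrite geq_min orbC => ->.
move: le_k (mem_index_enum x); rewrite /min_set; elim: (index_enum _) => //= y r IHr.
rewrite big_cons inE => le_k /predU1P[xy | r_x]; last first.
  by apply: IHr => //; move: le_k; case: (y \in A); rewrite // leq_min => /andP[].
by move: le_k; rewrite -xy Ax leq_min => /andP[].
Qed.

(** This form also covers empty sets, since every element of ['I_n] is below the default [n]. *)
Lemma min_set_leP A B : reflect
  (forall y, y \in B -> exists2 x, x \in A & x <= y) (min_set A <= min_set B).
Proof.
apply: (iffP idP) => [le_AB y By|le_AB].
  have le_Ay : min_set A <= y by have /leq_min_setP[_] := le_AB; apply.
  have [/exists_inP[x Ax le_xy]|] := boolP [exists x in A, x <= y]; first by exists x.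
  rewrite negb_exists_in => /forall_inP no; have : y < min_set A.
    by apply/leq_min_setP; split=> // x /no; rewrite -ltnNge.
  by rewrite ltnNge le_Ay.
have /leq_min_setP[le_An le_A] := leqnn (min_set A).
apply/leq_min_setP; split=> // y /le_AB[x Ax].
by apply: leq_trans; apply: le_A.
Qed.

Lemma min_set_mem A x : x \in A -> exists2 y, y \in A & y = min_set A :> nat.
Proof.
move=> Ax; case: (arg_minnP (fun i : 'I_n => nat_of_ord i) Ax) => y Ay le_y.
exists y => //; apply/eqP; rewrite eqn_leq; apply/andP; split.
  by apply/leq_min_setP; split=> //; apply: ltnW.
by have /leq_min_setP[_] := leqnn (min_set A); apply.
Qed.

Lemma IOPP a : reflect
  (a \in IP 'I_n /\ forall u v, min_set (uppers a u) <= min_set (uppers a v) ->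
     min_set (lowers a u) <= min_set (lowers a v))
  (a \in IOP n).
Proof.
apply: (iffP idP) => [|[aIP H]]; first rewrite inE => /andP[aIP H].
  have aCS := IP_CS aIP; split=> // u v.
  have /forall_inP/(_ _ (pblock_CS v aCS))/implyP := forall_inP H _ (pblock_CS u aCS).
  by rewrite !upper_pblock // !lower_pblock.
have aCS := IP_CS aIP; rewrite inE aIP /=.
apply/forall_inP => P /(block_pblock aCS)[u ->].
apply/forall_inP => Q /(block_pblock aCS)[v ->].
by apply/implyP; rewrite !upper_pblock // !lower_pblock //; apply: H.
Qed.

(* Order preservation extends from blocks to unions of blocks, because the     *)
(* least element of a union is the least element of one of its blocks.         *)
Lemma IOP_saturated a (S T : pred ('I_n + 'I_n)) : a \in IOP n ->
    (forall u v, same_block a u v -> S u -> S v) ->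
    (forall u v, same_block a u v -> T u -> T v) ->
    (exists x, S (inl x)) ->
    min_set [set x | S (inl x)] <= min_set [set x | T (inl x)] ->
  min_set [set x | S (inr x)] <= min_set [set x | T (inr x)].
Proof.
case/IOPP=> aIP a_op satS satT [x0 Sx0] /leq_min_setP[_ le_ST].
have [x Sx def_x] : exists2 x, x \in [set x | S (inl x)] &
    x = min_set [set x | S (inl x)] :> nat by apply: (@min_set_mem _ x0); rewrite inE.
have aCS := IP_CS aIP.
apply/min_set_leP => y; rewrite inE => Ty.
(* The block of [y] has its upper vertices in [T], so [x], the least upper element of [S], bounds
   them all. *)
have /a_op/min_set_leP/(_ y) : min_set (uppers a (inl x)) <= min_set (uppers a (inr y)).
  apply/min_set_leP => t; rewrite inE => yt; exists x.
    by rewrite inE same_block_refl.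
  by rewrite def_x le_ST // inE (satT _ _ yt).
rewrite inE same_block_refl // => /(_ isT)[z]; rewrite inE => xz le_zy.
by exists z; rewrite // inE (satS _ _ xz) //; move: Sx; rewrite inE.
Qed.

Lemma cs_mul_IOP a b : a \in IOP n -> b \in IOP n -> cs_mul a b \in IOP n.
Proof.
move=> aO bO; have [[aIP _] [bIP _]] := (IOPP _ aO, IOPP _ bO).
have [aCS bCS] := (IP_CS aIP, IP_CS bIP).
have mIP := cs_mul_IP aIP bIP; have mCS := IP_CS mIP.
apply/IOPP; split=> // u v le_up.
(* [E w] is the trace on the middle row of the product block of [w]. [Sa] joins it to the top of
   that block and is saturated for [a]; [Sb] joins it to the bottom and is saturated for [b]. *)
pose E w y := [exists t, middle a b w t && connect (middle_step a b) t y].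
pose Sa w t := match t with inl x => same_block (cs_mul a b) w (inl x) | inr y => E w y end.
pose Sb w t := match t with inl y => E w y | inr x => same_block (cs_mul a b) w (inr x) end.
have E_mid w t y : middle a b t y -> same_block (cs_mul a b) w t = E w y.
  move=> ty; apply/same_block_mulP/existsP => // [[p [q [wp tq pq]]]|[p /andP[wp pq]]].
    exists p; rewrite wp; apply: connect_trans pq _.
    exact: middle_connect tq ty.
  by exists p, y.
have E_step w y z : middle_step a b y z -> E w y -> E w z.
  move=> yz /existsP[t /andP[wt ty]]; apply/existsP; exists t.
  by rewrite wt; apply: connect_trans ty (connect1 yz).
have satSa w s t : same_block a s t -> Sa w s -> Sa w t.
  case: s t => [x|x] [y|y] st /=.
  - by move=> ws; apply: same_block_trans ws _; last apply: mul_upper.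
  - by rewrite (E_mid _ (inl x) y).
  - by rewrite same_block_sym in st; rewrite (E_mid _ (inl y) x).
  - by apply: E_step; rewrite /middle_step /= st orbT.
have satSb w s t : same_block b s t -> Sb w s -> Sb w t.
  case: s t => [x|x] [y|y] st /=.
  - by apply: E_step; rewrite /middle_step /= st.
  - by rewrite same_block_sym in st; rewrite (E_mid _ (inr y) x).
  - by rewrite (E_mid _ (inr x) y).
  - by move=> ws; apply: same_block_trans ws _; last apply: mul_lower.
apply: (IOP_saturated bO (satSb u) (satSb v)).
  by have [y uy] := middle_ex aIP bIP u; exists y; apply/existsP; exists y; rewrite uy /=.
by apply: (IOP_saturated aO (satSa u) (satSa v)); first apply: IP_upper.
Qed.

Lemma flip_IOP a : a \in IOP n -> flip a \in IOP n.
Proof.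
case/IOPP=> aIP a_op; have aCS := IP_CS aIP; have [fCS fE] := flip_CS aCS.
apply/IOPP; split=> [|u v]; first exact: flip_IP.
have fup w : uppers (flip a) w = lowers a (swap w) by apply/setP=> x; rewrite !inE fE.
have flo w : lowers (flip a) w = uppers a (swap w) by apply/setP=> x; rewrite !inE fE.
rewrite !fup !flo; move: (swap u) (swap v) => {u v fup flo} u v le_uv.
rewrite leqNgt; apply/negP => lt_vu.
(* A strict upper comparison the wrong way forces equal lower minima, hence a common lower vertex
   and a single block. *)
have eq_lo : min_set (lowers a u) = min_set (lowers a v).
  by apply/eqP; rewrite eqn_leq le_uv a_op // ltnW.
have lo_mem w : exists2 y, y \in lowers a w & y = min_set (lowers a w) :> nat.
  by have [y wy] := IP_lower w aIP; apply: (@min_set_mem _ y); rewrite inE.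
have [[y uy y_min] [z vz z_min]] := (lo_mem u, lo_mem v).
have eq_yz : y = z by apply: val_inj; rewrite /= y_min z_min.
move: uy vz; rewrite -{z z_min}eq_yz !inE => uy vy.
have uv : same_block a u v by apply: same_block_trans uy _; rewrite // same_block_sym.
suff eq_up : uppers a u = uppers a v by rewrite eq_up ltnn in lt_vu.
apply/setP=> x; rewrite !inE; apply/idP/idP; apply: same_block_trans => //.
by rewrite same_block_sym.
Qed.

Lemma IOP_neq0 : IOP n != set0.
Proof.
(* The witness is the identity, with blocks [{x, x'}]. *)
pose base (u : 'I_n + 'I_n) := match u with inl x => x | inr x => x end.
have [oneCS oneE] : equivalence_partition (fun u v => base u == base v) [set: _] \in CS 'I_n
  /\ same_block (equivalence_partition (fun u v => base u == base v) [set: _]) =2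
     (fun u v => base u == base v).
  apply: (@equivalence_partition_CS _ (fun u v => base u == base v)) => [u|u v|v u w].
  - exact: eqxx.
  - exact: eq_sym.
  - by move=> /eqP->.
set one := equivalence_partition _ _ in oneCS oneE.
apply/set0Pn; exists one; apply/IOPP; split=> [|u v].
  by apply: IP_intro => // u; exists (base u); rewrite oneE.
have lo_up w : lowers one w = uppers one w by apply/setP=> x; rewrite !inE !oneE.
by rewrite !lo_up.
Qed.

End Order.

Theorem theorem9 (n : nat) : inverse_subsemigroup (@cs_mul 'I_n) (IP 'I_n) (IOP n).
Proof.
split; first split.
- exact: IOP_neq0.
- by apply/subsetP=> a /IOPP[].
- by move=> a b; apply: cs_mul_IOP.
- move=> a aO; exists (flip a); split; last exact: flip_IOP.
  by have /IOPP[aIP _] := aO; apply: flip_unique_inverse.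
Qed.
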